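(* Let $\mathfrak{g}$ be the (1+1) centrally extended Poincaré Lie algebra, i.e. the real Lie algebra with basis $\{M,P_0,P_1,K\}$ and brackets $$[P_0,P_1]=0,\quad [K,P_0]=P_1,\quad [K,P_1]=M+P_0,\quad [M,\cdot]=0,$$ and let $\phi_c$ ($c>0$) be the contraction map $$\phi_c(M)=c^{-2}M,\quad \phi_c(P_0)=P_0,\quad \phi_c(P_1)=c^{-1}P_1,\quad \phi_c(K)=c^{-1}K,$$ with contraction parameter $\varepsilon=c^{-1}$, whose limit $c\to+\infty$ contracts $\mathfrak{g}$ to the (1+1) centrally extended Galilei Lie algebra $\mathfrak{g}'$: $[P_0,P_1]'=0$, $[K,P_0]'=P_1$, $[K,P_1]'=M$, $[M,\cdot]'=0$. Let $\alpha\neq0$. Then, up to isomorphism, the unique Lie bialgebra structure on $\mathfrak{g}$ whose fundamental Lie bialgebra contraction associated with $\phi_c$ is the Lie bialgebra structure on $\mathfrak{g}'$ given by $$\delta'(M)=\alpha\, M\wedge P_1,\quad \delta'(P_0)=0,\quad \delta'(P_1)=0,\quad \delta'(K)=\alpha\, K\wedge P_1$$ is $$\delta(M)=\alpha\, M\wedge P_1+\alpha\, P_0\wedge P_1,\quad \delta(P_0)=0,\quad \delta(P_1)=0,\quad \delta(K)=\alpha\, K\wedge P_1 .$$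
   Context: A Lie bialgebra structure on a Lie algebra $\mathfrak{g}$ is a linear map $\delta:\mathfrak{g}\to\mathfrak{g}\wedge\mathfrak{g}$ (cocommutator) that is a 1-cocycle, $\delta([X,Y])=\mathrm{ad}_X\delta(Y)-\mathrm{ad}_Y\delta(X)$, and whose dual $\delta^*:\mathfrak{g}^*\wedge\mathfrak{g}^*\to\mathfrak{g}^*$ satisfies the Jacobi identity. Contractions: given invertible linear maps $\phi_\varepsilon$ on the vector space underlying $\mathfrak{g}$, depending polynomially on $\varepsilon$, the contracted Lie algebra $\mathfrak{g}'$ (same underlying vector space) has bracket $[X,Y]'=\lim_{\varepsilon\to0}\phi_\varepsilon^{-1}[\phi_\varepsilon(X),\phi_\varepsilon(Y)]$, if the limit exists. For a Lie bialgebra $(\mathfrak{g},\eta)$ there is a minimal real number $n_0$ such that for all $n\ge n_0$ the limit $\lim_{\varepsilon\to0}\varepsilon^{n}(\phi_\varepsilon^{-1}\otimes\phi_\varepsilon^{-1})\circ\eta\circ\phi_\varepsilon$ exists (it is zero for $n>n_0$). The fundamental Lie bialgebra contraction of $(\mathfrak{g},\eta)$ associated with $\phi_\varepsilon$ is the Lie bialgebra $(\mathfrak{g}',\eta')$ with $$\eta'=\lim_{\varepsilon\to0}\varepsilon^{n_0}(\phi_\varepsilon^{-1}\otimes\phi_\varepsilon^{-1})\circ\eta\circ\phi_\varepsilon .$$ The factor $\varepsilon^{n_0}$ can equivalently be absorbed in a rescaling $\alpha\mapsto\varepsilon^{-n_0}\alpha$ of the deformation parameter; the coefficient $\alpha$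 in $\delta'$ denotes the rescaled parameter. An isomorphism of Lie bialgebras is a Lie algebra isomorphism intertwining the cocommutators. *)

(* Defs.v *)
From HB Require Import structures.
From mathcomp Require Import all_boot all_order all_algebra.
From mathcomp Require Import all_classical all_reals all_analysis.
Set Implicit Arguments.
Unset Strict Implicit.
Unset Printing Implicit Defensive.
Import Order.TTheory GRing.Theory Num.Theory.
Import numFieldNormedType.Exports.
Local Open Scope classical_set_scope.
Local Open Scope ring_scope.

(* Vectors of g = R^n are row vectors and linear maps act on the right, by    *)
(* x |-> x *m A. The tensor square of g is 'M[R]_n, the entry T i j being the *)
(* coefficient of e_i (x) e_j; elements of the exterior square are            *)
(* antisymmetric tensors.                                                     *)

Definition tens (R : realType) (n : nat) (u v : 'rV[R]_n) : 'M[R]_n :=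
  u^T *m v.

(* No factor 1/2. *)
Definition wedge (R : realType) (n : nat) (u v : 'rV[R]_n) : 'M[R]_n :=
  tens u v - tens v u.

(* A (x) A: it maps tens u v to tens (u *m A) (v *m A). *)
Definition tens_map (R : realType) (n : nat) (A T : 'M[R]_n) : 'M[R]_n :=
  A^T *m T *m A.

(* ad_x (x) 1 + 1 (x) ad_x, where lin1_mx (br x) is the matrix of ad_x. *)
Definition ad_tens (R : realType) (n : nat)
    (br : 'rV[R]_n -> 'rV[R]_n -> 'rV[R]_n) (x : 'rV[R]_n) (T : 'M[R]_n) :
    'M[R]_n :=
  (lin1_mx (br x))^T *m T + T *m lin1_mx (br x).

Definition jacobi (R : realType) (V : lmodType R) (br : V -> V -> V) : Prop :=
  forall x y z, br x (br y z) + br y (br z x) + br z (br x y) = 0.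

Definition lie_algebra (R : realType) (n : nat)
    (br : 'rV[R]_n -> 'rV[R]_n -> 'rV[R]_n) : Prop :=
  [/\ forall x, linear (br x),
      forall y, linear (br^~ y),
      forall x, br x x = 0
    & jacobi br].

(* The map dual to delta, linear functionals being column vectors: its value  *)
(* on xi, zeta is the functional x |-> <xi (x) zeta, delta x>.                *)
Definition dual_bracket (R : realType) (n : nat)
    (delta : 'rV[R]_n -> 'M[R]_n) (xi zeta : 'cV[R]_n) : 'cV[R]_n :=
  \col_i (xi^T *m delta (delta_mx 0 i) *m zeta) 0 0.

Definition lie_bialgebra (R : realType) (n : nat)
    (br : 'rV[R]_n -> 'rV[R]_n -> 'rV[R]_n) (delta : 'rV[R]_n -> 'M[R]_n) :
    Prop :=
  [/\ lie_algebra br,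
      linear delta,
      forall x, (delta x)^T = - delta x,
      forall x y,
        delta (br x y) = ad_tens br x (delta y) - ad_tens br y (delta x)
    & jacobi (dual_bracket delta)].

Definition lie_bialgebra_iso (R : realType) (n : nat)
    (br1 : 'rV[R]_n -> 'rV[R]_n -> 'rV[R]_n) (delta1 : 'rV[R]_n -> 'M[R]_n)
    (br2 : 'rV[R]_n -> 'rV[R]_n -> 'rV[R]_n) (delta2 : 'rV[R]_n -> 'M[R]_n) :
    Prop :=
  exists A : 'M[R]_n,
    [/\ A \in unitmx,
        forall x y, br1 x y *m A = br2 (x *m A) (y *m A)
      & forall x, delta2 (x *m A) = tens_map A (delta1 x)].

(* The parameter ranges over e > 0, since real powers of e are used below. *)
Definition contraction_maps (R : realType) (n : nat) (phi : R -> 'M[R]_n) :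
    Prop :=
  (forall e, 0 < e -> phi e \in unitmx) /\
  exists Phi : 'M[{poly R}]_n,
    forall e, 0 < e -> phi e = map_mx (horner_eval e) Phi.

Definition contracted_bracket (R : realType) (n : nat) (phi : R -> 'M[R]_n)
    (br br' : 'rV[R]_n -> 'rV[R]_n -> 'rV[R]_n) : Prop :=
  forall x y,
    br (x *m phi e) (y *m phi e) *m invmx (phi e) @[e --> 0^'+] --> br' x y.

(* e^s (phi_e^-1 (x) phi_e^-1) o eta o phi_e, at x *)
Definition rescaled (R : realType) (n : nat) (phi : R -> 'M[R]_n)
    (eta : 'rV[R]_n -> 'M[R]_n) (s : R) (x : 'rV[R]_n) (e : R) : 'M[R]_n :=
  (e `^ s) *: tens_map (invmx (phi e)) (eta (x *m phi e)).

Definition limit_exists (R : realType) (n : nat) (phi : R -> 'M[R]_n)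
    (eta : 'rV[R]_n -> 'M[R]_n) (s : R) : Prop :=
  forall x, cvg (rescaled phi eta s x e @[e --> 0^'+]).

Definition minimal_exponent (R : realType) (n : nat) (phi : R -> 'M[R]_n)
    (eta : 'rV[R]_n -> 'M[R]_n) (n0 : R) : Prop :=
  (forall s, n0 <= s -> limit_exists phi eta s) /\
  (forall m, (forall s, m <= s -> limit_exists phi eta s) -> n0 <= m).

Definition fundamental_contraction (R : realType) (n : nat)
    (phi : R -> 'M[R]_n)
    (br : 'rV[R]_n -> 'rV[R]_n -> 'rV[R]_n) (eta : 'rV[R]_n -> 'M[R]_n)
    (br' : 'rV[R]_n -> 'rV[R]_n -> 'rV[R]_n) (eta' : 'rV[R]_n -> 'M[R]_n) :
    Prop :=
  [/\ contraction_maps phi,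
      contracted_bracket phi br br'
    & exists2 n0 : R, minimal_exponent phi eta n0 &
        forall x, rescaled phi eta n0 x e @[e --> 0^'+] --> eta' x].

(* The (bi)linear map with given values on the standard basis. *)
Definition linear_ext (R : realType) (V : lmodType R) (n : nat) (s : seq V)
    (x : 'rV[R]_n) : V :=
  \sum_(i < n) x 0 i *: s`_i.

Definition bilinear_ext (R : realType) (V : lmodType R) (n : nat)
    (t : seq (seq V)) (x y : 'rV[R]_n) : V :=
  \sum_(i < n) \sum_(j < n) (x 0 i * y 0 j) *: (nth [::] t i)`_j.

(* The ordered basis is (M, P0, P1, K). *)
Definition gM (R : realType) : 'rV[R]_4 := delta_mx 0 0.
Definition gP0 (R : realType) : 'rV[R]_4 := delta_mx 0 1.
Definition gP1 (R : realType) : 'rV[R]_4 := delta_mx 0 2.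
Definition gK (R : realType) : 'rV[R]_4 := delta_mx 0 3.
Arguments gM {R}.
Arguments gP0 {R}.
Arguments gP1 {R}.
Arguments gK {R}.

Definition poincare_bracket (R : realType) :
    'rV[R]_4 -> 'rV[R]_4 -> 'rV[R]_4 :=
  bilinear_ext
    [:: [:: 0; 0;   0;        0];
        [:: 0; 0;   0;        - gP1];
        [:: 0; 0;   0;        - (gM + gP0)];
        [:: 0; gP1; gM + gP0; 0]].

Definition galilei_bracket (R : realType) :
    'rV[R]_4 -> 'rV[R]_4 -> 'rV[R]_4 :=
  bilinear_ext
    [:: [:: 0; 0;   0;  0];
        [:: 0; 0;   0;  - gP1];
        [:: 0; 0;   0;  - gM];
        [:: 0; gP1; gM; 0]].

(* Row i is the image of the i-th basis vector. *)
Definition phi_c (R : realType) (c : R) : 'M[R]_4 :=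
  \matrix_(i < 4) [:: c ^- 2 *: gM; gP0; c^-1 *: gP1; c^-1 *: gK]`_i.

Definition phi_eps (R : realType) (e : R) : 'M[R]_4 := phi_c e^-1.

Definition poincare_delta (R : realType) (alpha : R) : 'rV[R]_4 -> 'M[R]_4 :=
  linear_ext
    [:: alpha *: wedge gM gP1 + alpha *: wedge gP0 gP1;
        0;
        0;
        alpha *: wedge gK gP1].

Definition galilei_delta (R : realType) (alpha : R) : 'rV[R]_4 -> 'M[R]_4 :=
  linear_ext [:: alpha *: wedge gM gP1; 0; 0; alpha *: wedge gK gP1].

(* Main.v *)
From HB Require Import structures.
Require Import Defs.
From mathcomp Require Import all_boot all_order all_algebra.
From mathcomp Require Import all_classical all_reals all_analysis.
From mathcomp Require Import ring.
Import Order.TTheory GRing.Theory Num.Theory.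
Import numFieldNormedType.Exports.
Set Implicit Arguments.
Unset Strict Implicit.
Unset Printing Implicit Defensive.
Local Open Scope classical_set_scope.
Local Open Scope ring_scope.

(* Replacing M + P0 by M + t P0 in the Poincare structure gives Lie           *)
(* bialgebras b_t interpolating between Galilei (t = 0) and Poincare (t = 1), *)
(* and phi_e maps b_(e^2) to b_1 up to the factor e on the cocommutator: the  *)
(* contraction is t -> 0, with n0 = 1.                                        *)
(* Conversely, phi_e is diagonal, with weights 2, 0, 1, 1 on M, P0, P1, K, so *)
(* the coefficient of e_j (x) e_k in eta(e_i) scales as                       *)
(* e^(n0 + w_i - w_j - w_k). As alpha <> 0, the coefficient alpha of M ^ P1   *)
(* in delta'(M) forces n0 = 1, and every coefficient with                     *)
(* w_i + 1 <= w_j + w_k agrees with that of delta'. This leaves eta(P0) = 0   *)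
(* and eta(K) = alpha K ^ P1 + c P0 ^ P1 + d P0 ^ K; the cocycle condition on *)
(* [K,P0], [K,P1] determines eta(P1) and eta(M), and on [K,M] gives d = 0.    *)
(* The automorphism K |-> K - (c / alpha) P0 removes c.                       *)

(** Existence rests on one observation: the map [phi_eps e] sends M + e^2 P0 to e^2 (M + P0), so it
    intertwines two members of the family ([bracket_fam_phi_eps], [delta_fam_phi_eps]) and the
    contraction becomes continuity at t = 0 ([fundamental_contraction_fam]). For uniqueness,
    comparing powers of e fixes most coefficients of [eta] ([fundamental_contraction_entry]), the
    cocycle condition leaves a single free parameter ([poincare_cobracket_classification]), and an
    automorphism absorbs it ([lie_bialgebra_iso_shear]). *)

Definition bracket_fam (R : realType) (t : R) (x y : 'rV[R]_4) : 'rV[R]_4 :=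
  (x 0 3 * y 0 1 - x 0 1 * y 0 3) *: gP1 +
  (x 0 3 * y 0 2 - x 0 2 * y 0 3) *: (gM + t *: gP0).

Definition delta_fam (R : realType) (alpha t : R) (x : 'rV[R]_4) : 'M[R]_4 :=
  alpha *: wedge (x 0 0 *: (gM + t *: gP0) + x 0 3 *: gK) gP1.

Lemma ord4P (P : 'I_4 -> Prop) : P 0 -> P 1 -> P 2 -> P 3 -> forall i, P i.
Proof.
move=> P0 P1 P2 P3 [[|[|[|[|//]]]] lt_i]; set i := Ordinal _.
- by have -> : i = 0 by apply/val_inj.
- by have -> : i = 1 by apply/val_inj.
- by have -> : i = 2 by apply/val_inj.
- by have -> : i = 3 by apply/val_inj.
Qed.

Lemma big_ord4 (V : nmodType) (F : 'I_4 -> V) :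
  \sum_(i < 4) F i = F 0 + F 1 + F 2 + F 3.
Proof.
rewrite !big_ord_recl big_ord0 addr0 !addrA.
by congr (F _ + F _ + F _ + F _); apply: val_inj.
Qed.

Lemma poincare_bracketE (R : realType) : @poincare_bracket R = bracket_fam 1.
Proof.
apply/funext => x; apply/funext => y; apply/rowP.
rewrite /poincare_bracket /bilinear_ext !big_ord4 /bracket_fam /=.
by elim/ord4P; rewrite !mxE /=; ring.
Qed.

Lemma galilei_bracketE (R : realType) : @galilei_bracket R = bracket_fam 0.
Proof.
apply/funext => x; apply/funext => y; apply/rowP.
rewrite /galilei_bracket /bilinear_ext !big_ord4 /bracket_fam /=.
by elim/ord4P; rewrite !mxE /=; ring.
Qed.

Lemma lie_algebra_fam (R : realType) (t : R) : lie_algebra (bracket_fam t).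
Proof.
split=> [x c y z|x c y z|x|x y z]; apply/rowP => i;
  rewrite /bracket_fam !mxE /=; ring.
Qed.

Lemma wedgeE (R : realType) n (u v : 'rV[R]_n) i j :
  wedge u v i j = u 0 i * v 0 j - v 0 i * u 0 j.
Proof. by rewrite !mxE !big_ord1 !mxE. Qed.

Lemma poincare_deltaE (R : realType) (alpha : R) :
  poincare_delta alpha = delta_fam alpha 1.
Proof.
apply/funext => x; rewrite /poincare_delta /linear_ext big_ord4 /delta_fam /=.
by apply/matrixP => i j; rewrite !(wedgeE, mxE) /=; ring.
Qed.

Lemma galilei_deltaE (R : realType) (alpha : R) :
  galilei_delta alpha = delta_fam alpha 0.
Proof.
apply/funext => x; rewrite /galilei_delta /linear_ext big_ord4 /delta_fam /=.
by apply/matrixP => i j; rewrite !(wedgeE, mxE) /=; ring.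
Qed.

(** The derivation rule, which reduces every cocycle check below to brackets of vectors. *)
Lemma ad_tens_wedge (R : realType) n (br : 'rV[R]_n -> 'rV[R]_n -> 'rV[R]_n)
    (x u v : 'rV[R]_n) :
  linear (br x) ->
  ad_tens br x (wedge u v) = wedge (br x u) v + wedge u (br x v).
Proof.
move=> br_lin.
(* Bundling the linearity of [br x] lets [lin1_mx (br x)] be recognised as its matrix. *)
pose f : {linear 'rV[R]_n -> 'rV[R]_n} :=
  HB.pack (br x) (GRing.isLinear.Build R _ _ _ (br x) br_lin).
have brE w : w *m lin1_mx (br x) = br x w by exact: (mul_rV_lin1 f).
rewrite /ad_tens /wedge /tens mulmxBl mulmxBr !mulmxA -!trmx_mul -!mulmxA !brE.
by rewrite addrACA [RHS]addrACA [X in _ + X = _]addrC.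
Qed.

Lemma wedge_pairing (R : realType) n (u v : 'rV[R]_n) (xi zeta : 'cV[R]_n) :
  (xi^T *m wedge u v *m zeta) 0 0 =
  (u *m xi) 0 0 * (v *m zeta) 0 0 - (v *m xi) 0 0 * (u *m zeta) 0 0.
Proof.
have mulE (a b : 'M[R]_1) : (a^T *m b) 0 0 = a 0 0 * b 0 0.
  by rewrite !mxE big_ord1 mxE.
rewrite /wedge /tens mulmxBr mulmxBl !mulmxA -!trmx_mul -!mulmxA.
by rewrite -!mulE [LHS]mxE [X in _ + X]mxE.
Qed.

(** The dual algebra is a semidirect product: the functionals dual to M, P0, K span an abelian
    ideal, on which the one dual to P1 acts. This is why Jacobi holds for every t. *)
Lemma dual_bracket_fam (R : realType) (alpha t : R) (u v : 'cV[R]_4) :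
  dual_bracket (delta_fam alpha t) u v =
  alpha *:
    (((u 0 0 + t * u 1 0) * v 2 0 - u 2 0 * (v 0 0 + t * v 1 0)) *: delta_mx 0 0
       + (u 3 0 * v 2 0 - u 2 0 * v 3 0) *: delta_mx 3 0).
Proof.
apply/colP => i; rewrite mxE /delta_fam -scalemxAr -scalemxAl [LHS]mxE.
rewrite wedge_pairing !mulmxDl -!scalemxAl !mulmxDl -!scalemxAl -!rowE.
by elim/ord4P: i; rewrite !mxE /=; ring.
Qed.

Lemma lie_bialgebra_fam (R : realType) (alpha t : R) :
  lie_bialgebra (bracket_fam t) (delta_fam alpha t).
Proof.
have br_lie := lie_algebra_fam t; split=> //.
- move=> c x y; apply/matrixP => i j.
  by rewrite /delta_fam !(wedgeE, mxE) /=; ring.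
- move=> x; apply/matrixP => i j.
  by rewrite /delta_fam !(wedgeE, mxE) /=; ring.
- move=> x y; rewrite /delta_fam /ad_tens -!scalemxAl -!scalemxAr -!scalerDr.
  rewrite -!/(ad_tens _ _ _).
  have [br_lin _ _ _] := br_lie; rewrite !ad_tens_wedge //.
  have brP1 u : bracket_fam t u gP1 = u 0 3 *: (gM + t *: gP0).
    by apply/rowP => i; rewrite /bracket_fam !mxE /=; ring.
  have br_arg u v :
      bracket_fam t u (v 0 0 *: (gM + t *: gP0) + v 0 3 *: gK) =
      (t * v 0 0 * u 0 3 - u 0 1 * v 0 3) *: gP1
        - (u 0 2 * v 0 3) *: (gM + t *: gP0).
    by apply/rowP => i; rewrite /bracket_fam !mxE /=; ring.
  rewrite !brP1 !br_arg /bracket_fam.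
  by apply/matrixP => i j; rewrite !(wedgeE, mxE) /=; ring.
- move=> x y z; rewrite !dual_bracket_fam; apply/colP => i.
  by rewrite !mxE /=; ring.
Qed.

(** * Weights of the contraction map and its action on the family *)

Definition wt (i : 'I_4) : nat := nth 0%N [:: 2; 0; 1; 1]%N i.

Lemma phi_epsE (R : realType) (e : R) :
  phi_eps e = diag_mx (\row_i e ^+ wt i).
Proof.
apply/matrixP; rewrite /phi_eps /phi_c.
by elim/ord4P; elim/ord4P;
  rewrite mxE [LHS]mxE /= ?mxE /= -?exprVn ?invrK /wt /=; ring.
Qed.

Lemma phi_eps_unit (R : realType) (e : R) : 0 < e -> phi_eps e \in unitmx.
Proof.
move=> e0; rewrite phi_epsE unitmxE det_diag unitfE prodf_seq_neq0.
by apply/allP => i _; rewrite mxE expf_neq0 // gt_eqF.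
Qed.

Lemma invmx_phi_eps (R : realType) (e : R) : 0 < e ->
  invmx (phi_eps e) = diag_mx (\row_i e ^- wt i).
Proof.
move=> e0; rewrite -[RHS]mul1mx -(mulVmx (phi_eps_unit e0)) -mulmxA.
rewrite phi_epsE mulmx_diag -[LHS]mulmx1; congr (_ *m _).
by apply/matrixP => i j; rewrite !mxE divff // expf_neq0 // gt_eqF.
Qed.

Lemma contraction_maps_phi_eps (R : realType) : contraction_maps (@phi_eps R).
Proof.
split=> [e|]; first exact: phi_eps_unit.
exists (diag_mx (\row_i 'X ^+ wt i)) => e e0; rewrite phi_epsE.
by apply/matrixP => i j; rewrite !mxE raddfMn /= /horner_eval hornerXn.
Qed.

Lemma bracket_fam_phi_eps (R : realType) (e : R) (x y : 'rV[R]_4) :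
  bracket_fam 1 (x *m phi_eps e) (y *m phi_eps e) =
  bracket_fam (e ^+ 2) x y *m phi_eps e.
Proof.
rewrite phi_epsE !mul_mx_diag; apply/rowP; rewrite /bracket_fam.
elim/ord4P; rewrite !mxE /= /wt /=; ring.
Qed.

Lemma delta_fam_phi_eps (R : realType) (alpha e : R) (x : 'rV[R]_4) :
  e *: delta_fam alpha 1 (x *m phi_eps e) =
  tens_map (phi_eps e) (delta_fam alpha (e ^+ 2) x).
Proof.
rewrite phi_epsE /tens_map tr_diag_mx mul_diag_mx !mul_mx_diag.
apply/matrixP; rewrite /delta_fam.
elim/ord4P; elim/ord4P; rewrite !(mxE, big_ord1) /= /wt /=; ring.
Qed.

Lemma tens_mapK (R : realType) n (A T : 'M[R]_n) : A \in unitmx ->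
  tens_map (invmx A) (tens_map A T) = T.
Proof.
move=> Au; rewrite /tens_map !mulmxA -trmx_mul mulmxV // trmx1 mul1mx.
by rewrite -mulmxA mulmxV // mulmx1.
Qed.

Lemma tens_mapZ (R : realType) n (A T : 'M[R]_n) c :
  tens_map A (c *: T) = c *: tens_map A T.
Proof. by rewrite /tens_map -scalemxAr -scalemxAl. Qed.

(** The shift by 1 in the exponent is the factor e of [delta_fam_phi_eps]; it is the source of n0 =
    1. *)
Lemma rescaled_fam (R : realType) (alpha s e : R) (x : 'rV[R]_4) : 0 < e ->
  rescaled (@phi_eps R) (delta_fam alpha 1) s x e =
  e `^ (s - 1) *: delta_fam alpha (e ^+ 2) x.
Proof.
move=> e0; rewrite -[delta_fam _ (e ^+ 2) x](tens_mapK _ (phi_eps_unit e0)).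
rewrite -delta_fam_phi_eps tens_mapZ scalerA /rescaled; congr (_ *: _).
have e_neq0 : e != 0 by rewrite gt_eqF.
by rewrite powRB ?e_neq0 ?implybT // powRr1 ?ltW // divfK.
Qed.

(** * Limits of powers and existence of the contraction *)

Lemma powR_scale_cvg (R : realType) (V : normedModType R) (r : R)
    (f : R -> V) (l : V) :
  0 <= r -> f e @[e --> 0^'+] --> l ->
  e `^ r *: f e @[e --> 0^'+] --> (if r == 0 then l else 0).
Proof.
rewrite le0r => /predU1P[-> fl|r0 fl].
  by rewrite eqxx; under eq_fun do rewrite powRr0 scale1r.
rewrite gt_eqF // -(scale0r l); by apply: cvgZ fl; exact: powR_cvg0.
Qed.

(** Multiplying by e^(-r), which tends to 0, turns the convergent function into the constant a;
    hence a = 0, and then b = 0. *)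
Lemma powR_cvg_neg (R : realType) (r a b : R) :
  r < 0 -> e `^ r * a @[e --> 0^'+] --> b -> a = 0 /\ b = 0.
Proof.
move=> r0 ab.
have lim0 : e `^ (- r) * (e `^ r * a) @[e --> 0^'+] --> 0 * b.
  by apply: cvgM => //; apply: powR_cvg0; rewrite oppr_gt0.
have lima : e `^ (- r) * (e `^ r * a) @[e --> 0^'+] --> a.
  apply: cvg_near_cst; near=> e.
  by rewrite mulrA -powRD ?addNr ?powRr0 ?mul1r // eqxx /= gt_eqF.
have a0 : a = 0 by rewrite (cvg_unique _ lima lim0) ?mul0r.
split=> //; move: ab; rewrite a0; under eq_fun do rewrite mulr0.
by move=> lim_b; apply: cvg_unique lim_b (cvg_cst _).
Unshelve. all: by end_near.
Qed.

Lemma cvg_mx_entry (R : realType) (m n : nat) (T : Type) (F : set_system T)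
    (f : T -> 'M[R]_(m, n)) (A : 'M[R]_(m, n)) i j :
  Filter F -> f x @[x --> F] --> A -> f x i j @[x --> F] --> A i j.
Proof.
move=> FF fA.
apply: (@cvg_comp _ _ _ f (fun M : 'M[R]_(m, n) => M i j) _ _ _ fA).
exact: coord_continuous.
Qed.

Lemma delta_fam_affine (R : realType) (alpha t : R) (x : 'rV[R]_4) :
  delta_fam alpha t x =
  delta_fam alpha 0 x + t *: wedge (alpha *: (x 0 0 *: gP0)) gP1.
Proof.
apply/matrixP => i j; rewrite /delta_fam !(wedgeE, mxE) /=; ring.
Qed.

Lemma fundamental_contraction_fam (R : realType) (alpha : R) :
  alpha != 0 ->
  fundamental_contraction (@phi_eps R) (bracket_fam 1) (delta_fam alpha 1)
    (bracket_fam 0) (delta_fam alpha 0).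
Proof.
move=> alpha0.
have sqr0 : (e ^+ 2 : R) @[e --> 0^'+] --> (0 : R).
  apply: cvg_at_right_filter; rewrite -[X in _ --> X](expr0n _ 2).
  exact: exprn_continuous.
have fam0 x : delta_fam alpha (e ^+ 2) x @[e --> 0^'+] --> delta_fam alpha 0 x.
  under eq_fun do rewrite delta_fam_affine.
  set w := wedge _ _; have : delta_fam alpha 0 x + e ^+ 2 *: w
      @[e --> 0^'+] --> delta_fam alpha 0 x + 0 *: w.
    by apply: cvgD; [exact: cvg_cst | apply: cvgZ => //; exact: cvg_cst].
  by rewrite scale0r addr0.
have lim s x : 1 <= s ->
    rescaled (@phi_eps R) (delta_fam alpha 1) s x e @[e --> 0^'+] -->
    (if s - 1 == 0 then delta_fam alpha 0 x else 0).
  rewrite -subr_ge0 => s1; apply: cvg_trans (powR_scale_cvg s1 (@fam0 x)).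
  apply: near_eq_cvg; near=> e.
  by rewrite rescaled_fam.
split; first exact: contraction_maps_phi_eps.
- move=> x y.
  have : bracket_fam (e ^+ 2) x y @[e --> 0^'+] --> bracket_fam 0 x y.
    rewrite /bracket_fam; apply: cvgD; first exact: cvg_cst.
    apply: cvgZ; first exact: cvg_cst.
    apply: cvgD; first exact: cvg_cst.
    by apply: cvgZ => //; exact: cvg_cst.
  apply: cvg_trans; apply: near_eq_cvg; near=> e.
  by rewrite bracket_fam_phi_eps mulmxK // phi_eps_unit.
exists 1; last by move=> x; have := @lim 1 x (lexx _); rewrite subrr eqxx.
split=> [s s1 x|m lim_m]; first by apply: cvgP; exact: lim.
rewrite leNgt; apply/negP => m1.
have /cvg_ex[T limT] := lim_m m (lexx m) gM.
have limT' : rescaled (@phi_eps R) (delta_fam alpha 1) m gM e 0 2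
    @[e --> 0^'+] --> T 0 2.
  exact: cvg_mx_entry limT.
(* Minimality of 1: for m < 1 the M (x) P1 coefficient at M would blow up, as alpha is nonzero. *)
suff H : e `^ (m - 1) * alpha @[e --> 0^'+] --> T 0 2.
  have [] := powR_cvg_neg _ H; first by rewrite subr_lt0.
  by move=> /eqP; rewrite (negPf alpha0).
apply: cvg_trans limT'; apply: near_eq_cvg; near=> e.
by rewrite rescaled_fam // /delta_fam !mxE !big_ord1 !mxE /=; ring.
Unshelve. all: by end_near.
Qed.

(** * Coefficients determined by the limit *)

Lemma rescaled_entry (R : realType) (eta : 'rV[R]_4 -> 'M[R]_4) (s e : R)
    i j k :
  linear eta -> 0 < e ->
  rescaled (@phi_eps R) eta s (delta_mx 0 i) e j k =
  e `^ (s + (wt i)%:R - (wt j)%:R - (wt k)%:R) * eta (delta_mx 0 i) j k.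
Proof.
move=> eta_lin e0.
have etaZ c v : eta (c *: v) = c *: eta v.
  exact: (GRing.scalable_linear eta_lin).
rewrite /rescaled invmx_phi_eps // phi_epsE -rowE row_diag_mx etaZ.
rewrite /tens_map tr_diag_mx mul_mx_diag mul_diag_mx !mxE.
have e_neq0 : e != 0 by rewrite gt_eqF.
rewrite !powRB ?powRD ?e_neq0 ?implybT // !powR_mulrn ?ltW //.
by ring.
Qed.

Lemma fundamental_contraction_entry (R : realType) (alpha : R)
    (br br' : 'rV[R]_4 -> 'rV[R]_4 -> 'rV[R]_4) (eta : 'rV[R]_4 -> 'M[R]_4)
    i j k :
  alpha != 0 -> linear eta ->
  fundamental_contraction (@phi_eps R) br eta br' (delta_fam alpha 0) ->
  (wt i + 1 <= wt j + wt k)%N ->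
  eta (delta_mx 0 i) j k = delta_fam alpha 0 (delta_mx 0 i) j k.
Proof.
move=> alpha_neq0 eta_lin [_ _ [n0 _ lim_eta]].
have lim i' j' k' :
    e `^ (n0 + (wt i')%:R - (wt j')%:R - (wt k')%:R) * eta (delta_mx 0 i') j' k'
      @[e --> 0^'+] --> delta_fam alpha 0 (delta_mx 0 i') j' k'.
  have := lim_eta (delta_mx 0 i').
  move=> /(cvg_mx_entry (i := j') (j := k') _); apply: cvg_trans.
  by apply: near_eq_cvg; near=> e; rewrite rescaled_entry.
have n01 : n0 = 1.
  have deltaM : delta_fam alpha 0 gM 0 2 = alpha.
    by rewrite /delta_fam !(wedgeE, mxE) /=; ring.
  (* This coefficient has exponent n0 + 2 - 2 - 1. Its limit alpha is nonzero, which excludes n0 > 1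
     (limit 0) and n0 < 1 (no nonzero limit). *)
  have := lim 0 0 2; rewrite -/gM deltaM /wt /= addrK.
  move=> lim1; apply/eqP; rewrite -subr_eq0; move: lim1.
  case: (ltrgt0P (n0 - 1)) => // n0_sgn.
    have lim0 : e `^ (n0 - 1) * eta gM 0 2 @[e --> 0^'+] --> 0.
      have := powR_scale_cvg (ltW n0_sgn) (cvg_cst (eta gM 0 2)).
      by rewrite gt_eqF //; apply.
    move=> lim_alpha.
    have alpha0 : 0 = alpha by apply: cvg_unique lim0 lim_alpha.
    by move: alpha_neq0; rewrite -alpha0 eqxx.
  by move=> /(powR_cvg_neg n0_sgn)[_ /eqP]; rewrite (negPf alpha_neq0).
have := lim i j k; rewrite n01.
set r : R := 1 + (wt i)%:R - (wt j)%:R - (wt k)%:R => lim_r wt_le.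
(* For r = 0 the coefficient is its own limit; for r < 0 it and its limit both vanish. *)
have : r <= 0.
  by rewrite /r -addrA -opprD -natrD nat1r subr_le0 ler_nat -addn1.
rewrite le_eqVlt => /predU1P[r0|/powR_cvg_neg /(_ lim_r)[-> ->//]].
move: lim_r; rewrite r0; under eq_fun do rewrite powRr0 mul1r.
by move=> lim_r; apply: cvg_unique (cvg_cst _) lim_r.
Unshelve. all: by end_near.
Qed.

(** * Solving the cocycle condition *)

Lemma bracket_fam_K (R : realType) (t : R) (v : 'rV[R]_4) :
  bracket_fam t gK v = v 0 1 *: gP1 + v 0 2 *: (gM + t *: gP0).
Proof. by rewrite /bracket_fam !mxE /= !(mul1r, mul0r, subr0). Qed.

Lemma bracket_fam_P0 (R : realType) (t : R) (v : 'rV[R]_4) :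
  bracket_fam t gP0 v = - v 0 3 *: gP1.
Proof.
by rewrite /bracket_fam !mxE /=
  !(mulr0n, mulr1n, mul1r, mul0r, sub0r, subr0, oppr0, scale0r, addr0).
Qed.

Lemma bracket_fam_P1 (R : realType) (t : R) (v : 'rV[R]_4) :
  bracket_fam t gP1 v = - v 0 3 *: (gM + t *: gP0).
Proof.
by rewrite /bracket_fam !mxE /=
  !(mulr0n, mulr1n, mul1r, mul0r, sub0r, subr0, oppr0, scale0r, add0r).
Qed.

Lemma bracket_fam_M (R : realType) (t : R) (v : 'rV[R]_4) :
  bracket_fam t gM v = 0.
Proof.
by rewrite /bracket_fam !mxE /=
  !(mulr0n, mulr1n, mul1r, mul0r, sub0r, subr0, oppr0, scale0r, add0r).
Qed.

Lemma ad_tensD (R : realType) n (br : 'rV[R]_n -> 'rV[R]_n -> 'rV[R]_n) x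
    (T U : 'M[R]_n) : ad_tens br x (T + U) = ad_tens br x T + ad_tens br x U.
Proof. by rewrite /ad_tens mulmxDr mulmxDl addrACA. Qed.

Lemma tens_map_wedge (R : realType) n (A : 'M[R]_n) (u v : 'rV[R]_n) :
  tens_map A (wedge u v) = wedge (u *m A) (v *m A).
Proof.
by rewrite /tens_map /wedge /tens mulmxBr mulmxBl !trmx_mul !mulmxA.
Qed.

Lemma poincare_cobracket_classification (R : realType) (alpha : R)
    (eta : 'rV[R]_4 -> 'M[R]_4) :
  alpha != 0 -> lie_bialgebra (bracket_fam 1) eta ->
  fundamental_contraction (@phi_eps R) (bracket_fam 1) eta
    (bracket_fam 0) (delta_fam alpha 0) ->
  exists c : R, forall x,
    eta x = delta_fam alpha 1 x + (c * x 0 3) *: wedge gP0 gP1.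
Proof.
move=> alpha0 [br_lie eta_lin eta_anti eta_coc _] eta_contr.
have entry i j k := fundamental_contraction_entry (i := i) (j := j) (k := k)
  alpha0 eta_lin eta_contr.
have sk v j k : eta v j k = - eta v k j.
  by have /matrixP/(_ k j) := eta_anti v; rewrite !mxE.
have diag0 v j : eta v j j = 0.
  by apply/eqP; rewrite -eqNr -sk.
have eta0 : eta 0 = 0.
  by have := GRing.scalable_linear eta_lin 0 0; rewrite /= !scale0r.
have [br_lin _ _ _] := br_lie.
have eta_P0 : eta gP0 = 0.
  apply/matrixP.
  elim/ord4P; elim/ord4P; rewrite [RHS]mxE ?diag0 ?(@entry 1) //
    /delta_fam !(wedgeE, mxE) /=; ring.
(* Up to antisymmetry, P0 (x) P1 and P0 (x) K are the only off-diagonal positions of total weight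
   below 2, hence left open by [entry 3]. *)
pose c := eta gK 1 2; pose d := eta gK 1 3.
have eta_K : eta gK = wedge (alpha *: gK + c *: gP0) gP1 + wedge gP0 (d *: gK).
  apply/matrixP.
  have c' : eta gK 2 1 = - c by rewrite sk.
  have d' : eta gK 3 1 = - d by rewrite sk.
  elim/ord4P; elim/ord4P; rewrite ?diag0 ?c' ?d' -/c -/d ?(@entry 3) //
    /delta_fam !(wedgeE, mxE) /=; ring.
have br_KP0 : bracket_fam 1 gK gP0 = gP1 :> 'rV[R]_4.
  by rewrite bracket_fam_K !mxE /= !scale1r scale0r addr0.
(* The factor 1 gives the sum the shape that [eta_lin] rewrites. *)
have br_KP1 : bracket_fam 1 gK gP1 = 1 *: gM + gP0 :> 'rV[R]_4.
  by rewrite bracket_fam_K !mxE /= !scale1r scale0r add0r.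
have br_KM : bracket_fam 1 gK gM = 0 :> 'rV[R]_4.
  by rewrite bracket_fam_K !mxE /= !scale0r addr0.
have eta_P1 : eta gP1 = wedge gP0 (d *: gP1).
  rewrite -{1}br_KP0 eta_coc eta_P0 eta_K ad_tensD !ad_tens_wedge //.
  rewrite !bracket_fam_P0 /ad_tens mulmx0 mul0mx.
  by apply/matrixP => i j; rewrite !(wedgeE, mxE) /=; ring.
have eta_M : eta gM =
    wedge (alpha *: (gM + gP0)) gP1 + wedge gM (- d *+ 2 *: gP0).
  have := eta_coc gK gP1; rewrite br_KP1 eta_lin eta_P0 scale1r addr0 => ->.
  rewrite eta_P1 eta_K ad_tensD !ad_tens_wedge //.
  rewrite !bracket_fam_P1 !bracket_fam_K.
  by apply/matrixP => i j; rewrite !(wedgeE, mxE) /=; ring.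
(* M is central, so 0 = eta([K,M]) = ad_K eta(M) = -2d M ^ P1. *)
have d0 : d = 0.
  have := eta_coc gK gM; rewrite br_KM eta0.
  rewrite eta_M ad_tensD !ad_tens_wedge // !bracket_fam_K.
  rewrite eta_K ad_tensD !ad_tens_wedge // !bracket_fam_M.
  move=> /matrixP/(_ 0 2); rewrite !(wedgeE, mxE) /= => d0.
  have /eqP : - (d *+ 2) = 0 by rewrite [RHS]d0; ring.
  by rewrite oppr_eq0 mulrn_eq0 => /eqP.
exists c => x; rewrite [x in LHS]row_sum_delta big_ord4 -/gM -/gP0 -/gP1 -/gK.
(* The trailing 0 allows [eta_lin] to peel off the last term as well. *)
rewrite -!addrA -[x 0 3 *: gK]addr0.
rewrite !eta_lin eta_M eta_P0 eta_P1 eta_K d0 eta0.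
by apply/matrixP => i j; rewrite /delta_fam !(wedgeE, mxE) /=; ring.
Qed.

(** * Removing the last parameter *)

Lemma lie_bialgebra_iso_shear (R : realType) (alpha c : R)
    (eta : 'rV[R]_4 -> 'M[R]_4) :
  alpha != 0 ->
  (forall x, eta x = delta_fam alpha 1 x + (c * x 0 3) *: wedge gP0 gP1) ->
  lie_bialgebra_iso (bracket_fam 1) eta (bracket_fam 1) (delta_fam alpha 1).
Proof.
move=> alpha0 etaE.
pose N : 'M[R]_4 := delta_mx 3 1.
(* The shear K |-> K + s P0 sends (alpha K + c P0) ^ P1 to (alpha K + (alpha s + c) P0) ^ P1; this s
   cancels the P0 term. *)
pose s := - (c / alpha).
have mulA u : u *m (1%:M + s *: N) = u + (s * u 0 3) *: gP0.
  apply/rowP; rewrite mulmxDr mulmx1 -scalemxAr.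
  by elim/ord4P; rewrite !mxE big_ord4 !mxE /=; ring.
exists (1%:M + s *: N); split.
(* As N squares to 0, the inverse of 1 + s N is 1 - s N. *)
- have NN : N *m N = 0 by rewrite mul_delta_mx_0.
  apply: (proj1 (@mulmx1_unit _ _ _ (1%:M - s *: N) _)).
  rewrite mulmxDl mul1mx mulmxBr mulmx1 -scalemxAl -scalemxAr NN !scaler0 subr0.
  by rewrite subrK.
- move=> x y; rewrite !mulA /bracket_fam; apply/rowP.
  by elim/ord4P; rewrite !mxE /=; ring.
- move=> x; rewrite etaE /delta_fam mulA.
  set w := x 0 0 *: (gM + 1 *: gP0) + x 0 3 *: gK.
  have -> : alpha *: wedge w gP1 + (c * x 0 3) *: wedge gP0 gP1 =
      wedge (alpha *: w + (c * x 0 3) *: gP0) gP1.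
    by apply/matrixP => i j; rewrite !(wedgeE, mxE); ring.
  rewrite tens_map_wedge !mulA /w; apply/matrixP => i j.
  by rewrite !(wedgeE, mxE) /= /s; field.
Qed.

Theorem proposition4p1 (R : realType) (alpha : R) (halpha : alpha != 0) :
  [/\ lie_bialgebra (@galilei_bracket R) (galilei_delta alpha),
      lie_bialgebra (@poincare_bracket R) (poincare_delta alpha),
      fundamental_contraction (@phi_eps R)
        (@poincare_bracket R) (poincare_delta alpha)
        (@galilei_bracket R) (galilei_delta alpha)
    & forall eta : 'rV[R]_4 -> 'M[R]_4,
        lie_bialgebra (@poincare_bracket R) eta ->
        fundamental_contraction (@phi_eps R)
          (@poincare_bracket R) eta
          (@galilei_bracket R) (galilei_delta alpha) ->
        lie_bialgebra_iso (@poincare_bracket R) eta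
          (@poincare_bracket R) (poincare_delta alpha)].
Proof.
rewrite galilei_bracketE poincare_bracketE galilei_deltaE poincare_deltaE.
split; [exact: lie_bialgebra_fam|exact: lie_bialgebra_fam
  |exact: fundamental_contraction_fam|].
move=> eta eta_bialg eta_contr.
have [c etaE] := poincare_cobracket_classification halpha eta_bialg eta_contr.
exact: lie_bialgebra_iso_shear etaE.
Qed.
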